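(* For every $\varepsilon>0$, any algorithm that solves triangle or simplex enumeration with sufficiently high probability in hypergraphs on $n$ vertices with maximum density $\mu$ requires $\Omega(\mu^{1-\varepsilon}/\log n)$ rounds in the PRIMAL CONGEST (PC) model.
   Context: A hypergraph $H=(V,E)$ has vertex set $V$, $|V|=n$, and a set $E$ of nonempty subsets of $V$. For nonempty $U\subseteq V$ the restriction is $H[U]=(U,E[U])$ with $E[U]=\{e\cap U: e\in E,\ |e\cap U|\ge 2\}$; the density of $U$ is $\mu_H(U)=\frac1{|U|}\sum_{e\in E[U]}|e|$; the maximum density is $\mu(H)=\max_{\emptyset\ne U\subseteq V}\mu_H(U)$. A triangle is a simple cycle of length three $(v_0,e_0,v_1,e_1,v_2,e_2)$: distinct vertices, distinct edges, $v_i\in e_{i-1}\cap e_i$ (indices mod $3$); it is induced if moreover $v_i\notin e_{i+1}$ for each $i$. An $r$-dimensional simplex is a set of $r+1$ vertices all of whose $r$-element subsets are edges. In the triangle (simplex) enumeration problem each vertex outputs a set of triangles (simplices) such that these sets are pairwise disjoint and their union is the set of all triangles (simplices) of $H$; the triangle result applies both to all triangles and to all induced triangles. Computation: vertices are nodes with unique $O(\log n)$-bit IDs; synchronous rounds with unbounded local computation; algorithms may be randomized; $B=\Theta(\log n)$; initially each vertex knows its ID and its incident edges, including the IDs of the vertices in them ($\mathrm{KT}_1$). In PC, in each round each vertex $v$ can send a distinct $B$-bit message to each vertex sharing an edge with $v$ (one per such vertex). *)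

(* Defs.v *)
From HB Require Import structures.
From mathcomp Require Import all_boot all_order all_algebra.
From mathcomp Require Import all_classical all_reals all_analysis.

Set Implicit Arguments.
Unset Strict Implicit.
Unset Printing Implicit Defensive.

Import Order.TTheory GRing.Theory Num.Theory.
Import numFieldNormedType.Exports.

Local Open Scope ring_scope.

(* The ambient type [I] is the space of all possible identifiers; a vertex is
   identified with its ID, so the vertex set of an instance is a subset of [I],
   and ranging over all hypergraphs ranges over all assignments of unique IDs. *)
Record hypergraph (I : finType) := Hypergraph {
  vertices : {set I};
  edges : {set {set I}};
  edges_sub : forall e, e \in edges -> e \subset vertices;
  edges_neq0 : finset.set0 \notin edges }.

Section Hypergraphs.
Variable I : finType.
Implicit Types (H : hypergraph I) (U S e : {set I}).

(* As a set: distinct edges with the same trace on [U] are counted once. *)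
Definition restr_edges H U : {set {set I}} :=
  [set (e :&: U)%SET | e in edges H & (1 < #|(e :&: U)%SET|)%N].

Definition density (R : realType) H U : R :=
  (\sum_(f in restr_edges H U) #|f|)%N%:R / #|U|%:R.

(* All densities are nonnegative, so the default value 0 only matters when
   there are no vertices. *)
Definition max_density (R : realType) H : R :=
  \big[Num.max/0]_(U : {set I} | (U != finset.set0) && (U \subset vertices H))
    density R H U.

(* The cycle (v_0, e_0, v_1, e_1, v_2, e_2); index arithmetic in ['Z_3] is
   modulo 3.  Rotations and reflections of a cycle are distinct objects; nodes
   can pass to and from canonical representatives by local computation. *)
Definition cycle3 : finType :=
  ({ffun 'Z_3 -> I} * {ffun 'Z_3 -> {set I}})%type.

Definition is_triangle H (c : cycle3) : bool :=
  let: (v, e) := c in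
  [&& injectiveb v, injectiveb e, [forall i, v i \in vertices H],
      [forall i, e i \in edges H]
    & [forall i, v i \in (e (i - 1) :&: e i)%SET]].

Definition is_induced_triangle H (c : cycle3) : bool :=
  is_triangle H c && [forall i, c.1 i \notin c.2 (i + 1)].

Definition is_simplex_of_dim H (r : nat) S : bool :=
  [&& S \subset vertices H, #|S| == r.+1
    & [forall F : {set I}, (F \subset S) && (#|F| == r) ==> (F \in edges H)]].

(* The dimension of [S] can only be [#|S|.-1].  Dimension 1 is excluded: it
   would make any two vertices carrying singleton edges a simplex, even when
   they lie in different components, and no algorithm could enumerate those. *)
Definition is_simplex H S : bool :=
  (2 <= #|S|.-1)%N && is_simplex_of_dim H #|S|.-1 S.

Definition incident_edges H (v : I) : {set {set I}} :=
  [set e in edges H | v \in e].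

Definition share_edge H (u v : I) : bool :=
  (u != v) && [exists e in edges H, (u \in e) && (v \in e)].

End Hypergraphs.

Inductive problem := AllTriangles | InducedTriangles | AllSimplices.

Definition object (pb : problem) (I : finType) : finType :=
  match pb with
  | AllTriangles | InducedTriangles => cycle3 I
  | AllSimplices => {set I}
  end.

Definition objects (pb : problem) (I : finType) (H : hypergraph I) :
    {set object pb I} :=
  match pb return {set object pb I} with
  | AllTriangles => [set c | is_triangle H c]
  | InducedTriangles => [set c | is_induced_triangle H c]
  | AllSimplices => [set S | is_simplex H S]
  end.

Definition enumerates (pb : problem) (I : finType) (H : hypergraph I)
    (outs : I -> {set object pb I}) : Prop :=
  (forall u v, u \in vertices H -> v \in vertices H -> u != v ->
     [disjoint outs u & outs v]) /\
  (\bigcup_(v in vertices H) outs v)%SET = objects pb H.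

(* IDs are [l]-bit strings and messages are [b]-bit strings ([None] means that
   nothing is sent).  [init w v E] is the initial state of the node with ID [v]
   and set of incident edges [E] under the outcome [w] of the random source; a
   node may use any part of [w], at any later time, so that private coins (each
   node reads its own independent coordinate of [w]) and shared coins are both
   covered.  Local computation is unbounded: all fields are arbitrary
   functions. *)
Record pc_algorithm (Omega : Type) (l b : nat) (pb : problem) := PCAlgorithm {
  state : Type;
  init : Omega -> l.-tuple bool -> {set {set l.-tuple bool}} -> state;
  send : state -> l.-tuple bool -> option (b.-tuple bool);
  recv : state -> (l.-tuple bool -> option (b.-tuple bool)) -> state;
  output : state -> {set object pb (l.-tuple bool)} }.

Section Execution.
Variables (Omega : Type) (l b : nat) (pb : problem).
Variables (A : pc_algorithm Omega l b pb) (H : hypergraph (l.-tuple bool)).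

Fixpoint config (w : Omega) (t : nat) : l.-tuple bool -> state A :=
  match t with
  | 0 => fun v => init A w v (incident_edges H v)
  | t'.+1 => fun v =>
      recv (config w t' v)
        (fun u => if share_edge H u v then send (config w t' u) v else None)
  end.

Definition success (t : nat) : set Omega :=
  [set w | enumerates H (fun v => output (config w t v))]%classic.

End Execution.

(* Within [t] rounds, with probability at least [p], on every hypergraph with
   [n] vertices and maximum density at most [mu]. *)
Definition solves (R : realType) (d : measure_display) (Omega : measurableType d)
    (P : probability Omega R) (l b : nat) (pb : problem)
    (A : pc_algorithm Omega l b pb) (n : nat) (mu : R) (t : nat) (p : R) : Prop :=
  forall H : hypergraph (l.-tuple bool),
    #|vertices H| = n -> max_density R H <= mu ->
    measurable (success A H t) /\ (p%:E <= P (success A H t))%E.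

(* Main.v *)
(* Let C be a set of k vertices, where 2^k <= mu < 2^(k+1); every hypergraph with
   all its edges inside C has maximum density at most 2^k.  We place M = 2^k/poly(k)
   edge-disjoint gadgets on C: each gadget is a small set of edges that carries
   one triangle (resp. simplex) and, for every vertex v, contains an edge avoiding
   v.  A random input makes each gadget full or removes one of its edges.  At least
   M/2 gadgets are full with probability at least 1/2, so if an algorithm succeeds
   with probability 3/4, some vertex v of C has to output at least M/(2k) full
   gadgets on many inputs.  But v cannot see whether the edge avoiding v is
   there: for a fixed transcript of the messages v receives, its guess of m
   gadgets is correct with probability at most (k/(k+1))^m.  A union bound over
   the at most 2^((B+1)kt) transcripts gives t(B+1) >= 2^k/poly(k), and the
   polynomial in k = O(log mu) is absorbed by mu^eps. *)
Require Import Defs.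
From HB Require Import structures.
From mathcomp Require Import all_boot all_order all_algebra.
From mathcomp Require Import all_classical all_reals all_analysis.
From mathcomp Require Import measurable_realfun zify ring lra.

Set Implicit Arguments.
Unset Strict Implicit.
Unset Printing Implicit Defensive.

Import Order.TTheory GRing.Theory Num.Theory.
Import numFieldNormedType.Exports.

(** * Counting *)

Lemma card_ffun_forall (J A : finType) (P : J -> pred A) :
  #|[set x : {ffun J -> A} | [forall j, P j (x j)]]| = \prod_j #|P j|.
Proof.
have -> : \prod_j #|P j| = #|family P|.
  by rewrite card_family foldrE big_image.
apply: eq_card => x; rewrite inE.
by apply/forallP/familyP.
Qed.

(* [rho a] is the visible part of a coordinate [a] and [Z] the set of coordinates
   guessed to satisfy [G]: each guess costs a factor k/(k+1). *)
Lemma card_correct_guesses (J A C : finType) (rho : A -> C) (G : pred A)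
    (k m : nat) (Z : {ffun J -> C} -> {set J}) :
  (forall c, #|[pred a | (rho a == c) && G a]| * k.+1
             <= k * #|[pred a | rho a == c]|) ->
  #|[set x : {ffun J -> A} |
      let z := Z [ffun j => rho (x j)] in
      (m <= #|z|) && [forall (j | j \in z), G (x j)]]| * k.+1 ^ m <= k ^ m * #|A| ^ #|J|.
Proof.
move=> hG; rewrite -card_ffun -!sum1_card.
pose r (x : {ffun J -> A}) := [ffun j => rho (x j)].
set S := [set x | _].
have inS x : (x \in S) = (m <= #|Z (r x)|) && [forall (j | j \in Z (r x)), G (x j)].
  by rewrite inE.
(* Within one fibre of the visible part the guessed set is constant and the coordinates vary
   independently, so both counts become products over [J]. *)
rewrite (partition_big r xpredT) //= [in leqRHS](partition_big r xpredT) //=.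
rewrite big_distrl big_distrr; apply: leq_sum => c _ /=; rewrite !sum1_card.
have eqr x : (r x == c) = [forall j, rho (x j) == c j].
  apply/eqP/forallP => [<- j|h]; first by rewrite ffunE.
  by apply/ffunP => j; rewrite ffunE; apply/eqP.
have [mz|mz] := leqP m #|Z c|; last first.
  rewrite eq_card0 // => x; rewrite unfold_in /= inS; apply/negbTE.
  by case: eqP => [->|]; rewrite ?andbF // leqNgt mz.
pose P j := [pred a | (rho a == c j) && ((j \in Z c) ==> G a)].
pose Q j := [pred a | rho a == c j].
have -> : #|[pred x | (x \in S) && (r x == c)]| = \prod_j #|P j|.
  rewrite -card_ffun_forall; apply: eq_card => x; rewrite [in RHS]inE unfold_in /= inS.
  apply/andP/forallP => [[/andP[_ /forallP h] /eqP rx] j|h].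
    by rewrite /P /= -{1}rx ffunE eqxx -rx; apply: h.
  have rx : r x == c by rewrite eqr; apply/forallP => j; case/andP: (h j).
  rewrite (eqP rx) eqxx mz; split => //; apply/forallP => j.
  by case/andP: (h j).
have -> : #|[pred x | xpredT x & r x == c]| = \prod_j #|Q j|.
  by rewrite -card_ffun_forall; apply: eq_card => x; rewrite [in RHS]inE unfold_in /= eqr.
suff h : (\prod_j #|P j|) * k.+1 ^ #|Z c| <= k ^ #|Z c| * \prod_j #|Q j|.
  have kd : 0 < k.+1 ^ (#|Z c| - m) by rewrite expn_gt0.
  rewrite -(leq_pmul2r kd) -mulnA -expnD subnKC //.
  apply: leq_trans h _; rewrite -[in k ^ _](subnKC mz) expnD.
  rewrite -!mulnA leq_mul2l; apply/orP; right.
  rewrite mulnC leq_mul2l; apply/orP; right.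
  by case: (_ - _) => // d; rewrite leq_exp2r.
rewrite (bigID (mem (Z c))) [\prod_j #|Q j|](bigID (mem (Z c))) /=.
rewrite mulnAC mulnA -!prod_nat_const -!big_split /=.
apply: leq_mul; apply: leq_prod => j jZ.
  have -> : #|P j| = #|[pred a | (rho a == c j) && G a]|.
    by apply: eq_card => a; rewrite !inE jZ.
  exact: hG.
by apply: subset_leq_card; apply/fintype.subsetP => a; rewrite !inE => /andP[].
Qed.

(** Bernoulli's inequality for (1 + 1/k)^j, with denominators cleared. *)
Lemma bernoulli_nat (k j : nat) : k ^ j * (k + j) <= k * k.+1 ^ j.
Proof.
elim: j => [|j IH]; first by rewrite !expn0 addn0 mul1n muln1.
apply: leq_trans (_ : k ^ j * (k + j) * k.+1 <= _); last first.
  by rewrite expnSr mulnA leq_mul2r IH orbT.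
by rewrite expnSr -!mulnA leq_mul2l; apply/orP; right; nia.
Qed.

(** Since (1 + 1/k)^k is at least 2, every block of k guesses costs one bit. *)
Lemma double_pow_leq (k m : nat) : 0 < k ->
  2 ^ (m %/ k) * k ^ m <= k.+1 ^ m.
Proof.
move=> k0; have h : 2 * k ^ k <= k.+1 ^ k.
  rewrite -(leq_pmul2l k0); apply: leq_trans (bernoulli_nat k k).
  by nia.
rewrite {2 3}(divn_eq m k) !expnD ![(m %/ k) * k]mulnC !(expnM _ k) mulnA.
rewrite -expnMn; apply: leq_mul.
  by case: (m %/ k) => // n; rewrite leq_exp2r.
by case: (m %% k) => // n; rewrite leq_exp2r.
Qed.

(** Negating every boolean is an involution that sends inputs with less than half of the coordinates
    true to inputs with at least half true. *)
Lemma half_ffun_true (J Q : finType) :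
  #|{ffun J -> bool * Q}| <=
  2 * #|[set x : {ffun J -> bool * Q} | #|J| <= 2 * #|[set j | (x j).1]|]|.
Proof.
set S := [set x | _]; pose flip (x : {ffun J -> bool * Q}) :=
  [ffun j => (~~ (x j).1, (x j).2)].
have flipK : involutive flip.
  by move=> x; apply/ffunP => j; rewrite !ffunE /= negbK; case: (x j).
have h : ~: S \subset [set flip x | x in S].
  apply/fintype.subsetP => x; rewrite !inE -ltnNge => hx.
  apply/imsetP; exists (flip x); rewrite ?flipK // inE.
  have -> : [set j | (flip x j).1] = ~: [set j | (x j).1].
    by apply/finset.setP => j; rewrite !inE ffunE.
  move: hx; rewrite -(finset.cardsC [set j | (x j).1]).
  by rewrite !mul2n -!addnn ltn_add2l leq_add2r => /ltnW.
have := fintype.subset_leq_card h; rewrite card_imset; last exact: inv_inj.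
move=> {}h.
by rewrite -(finset.cardsC S) mul2n -addnn leq_add2l.
Qed.

(** * Random inputs and the information of a vertex *)

Lemma card_bigcup_leq (I T : finType) (F : I -> {set T}) :
  #|(\bigcup_i F i)%SET| <= \sum_i #|F i|.
Proof.
apply: (big_ind2 (fun (A : {set T}) n => #|A| <= n)) => //.
  by rewrite cards0.
move=> A m B n Am Bn; apply: leq_trans (leq_add Am Bn).
by rewrite cardsU leq_subr.
Qed.


(** Edge-disjointness lets the gadgets be damaged independently. [avoid j v] is the edge whose
    absence [v] cannot notice. In [gobjectP] the hypergraph is arbitrary, so the edges of other
    gadgets may be present. *)
Record gadgets (pb : problem) (I : finType) (C : {set I}) := Gadgets {
  gindex : finType;
  gedges : gindex -> {set {set I}};
  gobject : gindex -> object pb I;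
  avoid : gindex -> I -> {set I};
  gedges_sub : forall j e, e \in gedges j -> e \subset C;
  gedges_neq0 : forall j, finset.set0 \notin gedges j;
  gedges_disj : forall i j e, e \in gedges i -> e \in gedges j -> i = j;
  avoid_in : forall j v, avoid j v \in gedges j;
  avoidP : forall j v, v \notin avoid j v;
  gobjectP : forall j (H : hypergraph I), C \subset vertices H ->
    (gobject j \in objects pb H) = (gedges j \subset edges H) }.

Section GadgetHypergraph.
Variables (pb : problem) (I : finType) (C V : {set I}) (G : gadgets pb C).
Hypothesis CV : C \subset V.
Local Notation J := (gindex G).
Local Notation Q := {v : I | v \in C}.

(* State [(true, _)] of a gadget: all its edges are present; state [(false, q)]:
   its edge avoiding [q] is missing.  The idle component of full states makes
   flipping the boolean a bijection, so that half of the inputs have at least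
   half of their gadgets full, see [half_ffun_true]. *)
Definition input := {ffun J -> bool * Q}.
Implicit Type x : input.

Definition input_edges x : {set {set I}} :=
  [set e : {set I} | [exists j, (e \in gedges j) &&
    ((x j).1 || (e != avoid j (val (x j).2)))]].

Lemma input_edges_sub x e : e \in input_edges x -> e \subset C.
Proof. by rewrite inE => /existsP[j /andP[/gedges_sub]]. Qed.

Lemma input_edges_subV x e : e \in input_edges x -> e \subset V.
Proof. by move=> /input_edges_sub eC; apply: fintype.subset_trans CV. Qed.

Lemma input_edges_neq0 x : finset.set0 \notin input_edges x.
Proof.
apply/negP; rewrite inE => /existsP[j /andP[h _]].
by have := gedges_neq0 j; rewrite h.
Qed.

Definition input_hypergraph x : hypergraph I :=
  Hypergraph (@input_edges_subV x) (input_edges_neq0 x).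

(** A missing edge cannot be supplied by another gadget, because gadgets are edge-disjoint. *)
Lemma gobject_input x j :
  (gobject j \in objects pb (input_hypergraph x)) = (x j).1.
Proof.
rewrite gobjectP //; apply/fintype.subsetP/idP => [h|xj e ej].
  have := h _ (@avoid_in _ _ _ G j (val (x j).2)).
  rewrite inE => /existsP[i /andP[ie]].
  by rewrite (gedges_disj ie (avoid_in _ _)) eqxx orbF.
by rewrite inE; apply/existsP; exists j; rewrite ej xj.
Qed.

(* All that the vertex [v] can see of the state of a gadget. *)
Definition seen (v : Q) (a : bool * Q) : option Q :=
  if a.1 || (a.2 == v) then None else Some a.2.

Definition view (v : Q) (c : {ffun J -> option Q}) : {set {set I}} :=
  [set e : {set I} | (val v \in e) && [exists j, (e \in gedges j) &&
    (if c j is Some q then e != avoid j (val q) else true)]].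

(** The edge missing in state [(false, v)] does not contain [v], so to [v] this state looks full. *)
Lemma incident_input x (v : Q) :
  incident_edges (input_hypergraph x) (val v) = view v [ffun j => seen v (x j)].
Proof.
apply/finset.setP => e; rewrite !inE andbC; case ve : (val v \in e) => //=.
apply: eq_existsb => j; rewrite ffunE /seen; case: (_ \in gedges j) => //=.
case: (x j).1 => //=; case: ((x j).2 =P v) => // ->.
have -> // : e != avoid j (val v).
by apply: contraTneq ve => ->; apply: avoidP.
Qed.

Lemma incident_outside x u : u \notin C ->
  incident_edges (input_hypergraph x) u = finset.set0.
Proof.
move=> uC; apply/finset.setP => e; rewrite !inE; apply/negbTE.
apply/negP => /andP[ex ue]; move/negP: uC; apply.
by apply: (fintype.subsetP (@input_edges_sub x e _)) ue; rewrite inE.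
Qed.

Lemma share_input x u v : share_edge (input_hypergraph x) u v ->
  (u \in C) && (v \in C).
Proof.
move=> /andP[_ /existsP[e /andP[ex /andP[ue ve]]]].
by rewrite !(fintype.subsetP (input_edges_sub ex)).
Qed.

End GadgetHypergraph.

(** * Executions as functions of local input and received messages *)

Section Run.
Variables (Omega : Type) (l b : nat) (pb : problem).
Variables (A : pc_algorithm Omega l b pb) (w : Omega).
Local Notation I := (l.-tuple bool).
Local Notation message := (option (b.-tuple bool)).

Fixpoint run (v : I) (E : {set {set I}}) (msgs : nat -> I -> message) t
    : state A :=
  if t is t'.+1 then recv (run v E msgs t') (msgs t') else init A w v E.

Lemma eq_run v E m1 m2 t : (forall s u, (s < t)%N -> m1 s u = m2 s u) ->
  run v E m1 t = run v E m2 t.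
Proof.
elim: t => //= t IH h; rewrite IH => [|s u st]; last by apply: h; apply: ltnW.
by congr recv; apply: funext => u; apply: h.
Qed.

Lemma config_run (H : hypergraph I) t v :
  config A H w t v = run v (incident_edges H v) (fun s u =>
    if share_edge H u v then send (config A H w s u) v else None) t.
Proof. by elim: t => //= t ->. Qed.

End Run.

Section Counting.
Variables (Omega : Type) (l b : nat) (pb : problem).
Local Notation I := (l.-tuple bool).
Variables (A : pc_algorithm Omega l b pb) (w : Omega) (t : nat).
Variables (C V : {set I}) (G : gadgets pb C).
Hypothesis CV : C \subset V.
Local Notation J := (gindex G).
Local Notation Q := {v : I | v \in C}.
Local Notation message := (option (b.-tuple bool)).
Local Notation transcript := {ffun 'I_t * Q -> message}.

(** The value [None] is correct for senders outside [C], which share no edge with anyone; rounds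
    from [t] on do not influence the state after [t] rounds. *)
Definition received (tau : transcript) (s : nat) (u : I) : message :=
  if insub s is Some s' then if insub u is Some u' then tau (s', u') else None
  else None.

Definition outside_output : {set object pb I} :=
  (\bigcup_(u in V :\: C)
     output (run A w u finset.set0 (fun _ _ => None) t))%SET.

(* Vertices outside the core [C] have no edges, so what they output can be
   credited to each core vertex. *)
Definition credited (v : Q) (tau : transcript) (c : {ffun J -> option Q})
    : {set J} :=
  [set j | (gobject j \in output (run A w (val v) (view v c) (received tau) t))
           || (gobject j \in outside_output)].

Definition actual (x : input G) (v : Q) : transcript :=
  [ffun p : 'I_t * Q => let: (s, u) := p in let H := input_hypergraph CV x in
    if share_edge H (val u) (val v) then send (config A H w s (val u)) (val v)
    else None].

(** Once the transcript is fixed, the input influences the state of [v] only through the visible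
    parts of the gadgets; this is the form that [card_correct_guesses] requires. *)
Lemma config_core (x : input G) (v : Q) :
  config A (input_hypergraph CV x) w t (val v) =
  run A w (val v) (view v [ffun j => seen v (x j)]) (received (actual x v)) t.
Proof.
rewrite config_run incident_input; apply: eq_run => s u st.
rewrite /received insubT; case: insubP => [u' _ <-|uC]; first by rewrite ffunE.
by case: ifP => // /share_input; rewrite (negbTE uC).
Qed.

Lemma config_outside (x : input G) u : u \notin C ->
  config A (input_hypergraph CV x) w t u =
  run A w u finset.set0 (fun _ _ => None) t.
Proof.
move=> uC; rewrite config_run incident_outside //; apply: eq_run => s u' _.
by case: ifP => // /share_input; rewrite (negbTE uC) andbF.
Qed.

Definition solved : {set input G} :=
  [set x | `[< enumerates (input_hypergraph CV x)
                (fun v => output (config A (input_hypergraph CV x) w t v)) >]].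

Lemma credited_true (x : input G) v : x \in solved ->
  forall j, j \in credited v (actual x v) [ffun j => seen v (x j)] -> (x j).1.
Proof.
rewrite inE => /asboolP[_ /= hx] j; rewrite inE -config_core.
rewrite -(gobject_input CV) -hx => /orP[h|/bigcupP[u]].
  by apply/bigcupP; exists (val v) => //; apply: (fintype.subsetP CV); apply: valP.
rewrite inE => /andP[uC uV] h; apply/bigcupP; exists u => //.
by rewrite config_outside.
Qed.

Lemma true_credited (x : input G) : 0 < #|C| -> x \in solved ->
  forall j, (x j).1 ->
  exists v, j \in credited v (actual x v) [ffun j => seen v (x j)].
Proof.
move=> /card_gt0P[v0 v0C]; rewrite inE => /asboolP[_ /= hx] j.
rewrite -(gobject_input CV) -hx => /bigcupP[u uV h].
have [uC|uC] := boolP (u \in C).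
  by exists (Sub u uC); rewrite inE -config_core h.
exists (Sub v0 v0C); rewrite inE; apply/orP; right; apply/bigcupP; exists u.
  by rewrite inE uC.
by rewrite -(config_outside x).
Qed.

Lemma cardQ : #|{: Q}| = #|C|.
Proof. by rewrite card_sig; apply: eq_card => v; rewrite inE. Qed.

(** Seeing [Some q] rules out a full gadget. Seeing [None] leaves the |C| full states and the state
    [(false, v)], whence the ratio |C| / (|C| + 1). *)
Lemma card_seen (v : Q) c :
  #|[pred a | (seen v a == c) && a.1]| * #|C|.+1 <=
  #|C| * #|[pred a : bool * Q | seen v a == c]|.
Proof.
case: c => [q|].
  have -> // : #|[pred a | (seen v a == Some q) && a.1]| = 0%N.
  by apply: eq_card0 => -[[] q']; rewrite !inE /seen ?andbF.
pose T := [set (true, q) | q : Q].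
have cT : #|T| = #|C| by rewrite card_imset ?cardQ // => ? ? [].
have inT a : (a \in T) = a.1.
  by case: a => -[] q; apply/imsetP; [exists q | case].
have -> : #|[pred a | (seen v a == None) && a.1]| = #|C|.
  rewrite -cT; apply: eq_card => a; rewrite inT inE /seen.
  by case: a.1 => //; rewrite andbF.
rewrite leq_mul2l -cT; apply/orP; right.
have := cardsU1 (false, v) T; rewrite inT add1n => <-.
apply: fintype.subset_leq_card; apply/fintype.subsetP => a.
by rewrite !inE inT /seen => /orP[/eqP->|->] //=; rewrite eqxx.
Qed.

Lemma card_transcript : #|{: transcript}| = ((2 ^ b).+1 ^ (t * #|C|))%N.
Proof.
by rewrite card_ffun card_option card_tuple card_bool card_prod card_ord cardQ.
Qed.

Lemma counting_bound (m := #|J| %/ (2 * #|C|)) : 0 < #|C| ->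
  3 * #|{: input G}| <= 4 * #|solved| ->
  #|C|.+1 ^ m <= 4 * (#|C| * (2 ^ b).+1 ^ (t * #|C|)) * #|C| ^ m.
Proof.
move=> C0 hs.
(* Fractions 3/4 and 1/2 of the inputs overlap in at least 1/4 of them. *)
set many := [set x : input G | #|J| <= 2 * #|[set j | (x j).1]|].
have hmany : #|{: input G}| <= 2 * #|many| := half_ffun_true _ _.
have hI : #|{: input G}| <= 4 * #|solved :&: many|.
  have := cardsUI solved many; have := max_card (mem (solved :|: many)).
  move: hs hmany; move: #|_| #|_| #|_| #|_| #|_| => a1 a2 a3 a4 a5; lia.
(* The transcript in [p] need not be the one produced by [x]; this keeps the coordinates of [x]
   independent. *)
pose bad (p : Q * transcript) := [set x : input G |
  let z := credited p.1 p.2 [ffun j => seen p.1 (x j)] in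
  (m <= #|z|) && [forall (j | j \in z), (x j).1]].
have cov : solved :&: many \subset (\bigcup_p bad p)%SET.
  apply/fintype.subsetP => x; rewrite inE => /andP[xs]; rewrite inE => xm.
  pose z v := credited v (actual x v) [ffun j => seen v (x j)].
  have zfull v j : j \in z v -> (x j).1 by apply: credited_true.
  suff [v mz] : exists v, m <= #|z v|.
    apply/bigcupP; exists (v, actual x v) => //; rewrite inE /= mz.
    by apply/forallP => j; apply/implyP; apply: zfull.
  (* If every core vertex had fewer than [m] credited gadgets, at most |C| (m - 1) gadgets would be
     full, which is less than half of [J]. *)
  apply/existsP; apply: contraLR xm; rewrite negb_exists => /forallP zm.
  have hsub : [set j | (x j).1] \subset (\bigcup_v z v)%SET.
    apply/fintype.subsetP => j; rewrite inE => /(true_credited C0 xs)[v jz].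
    by apply/bigcupP; exists v.
  have := leq_trans (fintype.subset_leq_card hsub) (card_bigcup_leq _).
  have : \sum_v #|z v|.+1 <= #|C| * m.
    rewrite -cardQ -sum_nat_const; apply: leq_sum => v _.
    by rewrite ltnNge zm.
  rewrite (eq_bigr (fun v => #|z v| + 1)) => [|v _]; last by rewrite addn1.
  rewrite big_split /= sum1_card cardQ -ltnNge.
  have := leq_divM #|J| (2 * #|C|); rewrite -/m.
  move: (\sum_v _) #|_| #|_| #|_| C0 => s c k j; nia.
have X0 : 0 < #|{: input G}|.
  by rewrite card_ffun expn_gt0 card_prod card_bool cardQ muln_gt0 C0.
rewrite -(leq_pmul2r X0).
apply: leq_trans (_ : 4 * #|solved :&: many| * #|C|.+1 ^ m <= _).
  by rewrite mulnC leq_mul2r hI orbT.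
rewrite -!mulnA leq_mul2l /=.
apply: leq_trans (_ : (\sum_p #|bad p|) * #|C|.+1 ^ m <= _).
  rewrite leq_mul2r (leq_trans (fintype.subset_leq_card cov)) ?orbT //.
  exact: card_bigcup_leq.
rewrite big_distrl /= mulnA.
have <- : #|{: Q * transcript}| = (#|C| * (2 ^ b).+1 ^ (t * #|C|))%N.
  by rewrite card_prod cardQ card_transcript.
rewrite -sum_nat_const; apply: leq_sum => -[v tau] _.
rewrite card_ffun; apply: (@card_correct_guesses _ _ _ (seen v) (fun a => a.1) #|C| m (credited v tau)).
exact: card_seen.
Qed.

End Counting.

(** * Triangle and simplex gadgets *)

(** An edge of the 3-cycle on ['Z_3] is determined by its two endpoints. *)
Lemma Z3_eq (i j : 'Z_3) : (i == j) || (i == j + 1)%R ->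
  (i + 1 == j)%R || (i + 1 == j + 1)%R -> i == j.
Proof. by move: i j => [[|[|[|i]]] hi] [[|[|[|j]]] hj] //; vm_compute. Qed.

Section GadgetConstructions.
Variables (I : finType) (C : {set I}) (P : 'Z_3 -> I).
Hypotheses (PC : forall i, P i \in C) (Pinj : injective P).

Definition core_rest : {set I} := C :\: [set P i | i : 'Z_3].
Local Notation K := core_rest.
Implicit Types (T S : {set I}) (x v : I).

Lemma core_restP i : P i \notin K.
Proof. by rewrite inE imset_f. Qed.

Lemma core_rest_sub : K \subset C.
Proof. exact: finset.subsetDl. Qed.

Lemma card_core_rest : #|K| = #|C| - 3.
Proof.
rewrite cardsD (finset.setIidPr _); first by rewrite card_imset // card_ord.
by apply/fintype.subsetP => _ /imsetP[i _ ->].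
Qed.

(* The edges of the gadget of T are {P0, P1} + T, {P1, P2} + (K \ T) and
   {P2, P0} + T; they have no common vertex. *)
Definition tri_edge (T : {set I}) (i : 'Z_3) : {set I} :=
  P i |: (P (i + 1)%R |: (if i == 1%R then K :\: T else T)).

Lemma tri_edgeP T a i : T \subset K ->
  (P a \in tri_edge T i) = (a == i) || (a == i + 1)%R.
Proof.
move=> TK; rewrite !inE !(inj_eq Pinj).
suff /negbTE-> : P a \notin (if i == 1%R then K :\: T else T) by rewrite orbF.
have := core_restP a; apply: contra; case: ifP => _; first by rewrite inE => /andP[].
by apply: (fintype.subsetP TK).
Qed.

Lemma tri_edgeK T x i : x \in K ->
  (x \in tri_edge T i) = (x \in T) (+) (i == 1%R).
Proof.
move=> xK; rewrite !inE.
have xP a : (x == P a) = false.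
  by apply: contraTF xK => /eqP->; apply: core_restP.
by rewrite !xP /=; case: ifP => _; rewrite ?addbF // inE xK addbT andbT.
Qed.

(** The two corners in the edge determine [i]; its trace on [K] is then [T] or the complement of
    [T], according to [i]. This yields both distinct edges in a cycle and edge-disjoint gadgets. *)
Lemma tri_edge_inj T T' i i' : T \subset K -> T' \subset K ->
  tri_edge T i = tri_edge T' i' -> i = i' /\ T = T'.
Proof.
move=> TK TK' e; have ii' : i = i'.
  apply/eqP; apply: Z3_eq; rewrite -(tri_edgeP _ _ TK') -e tri_edgeP //.
    by rewrite eqxx.
  by rewrite eqxx orbT.
split=> //; apply/finset.setP => x; have [xK|xK] := boolP (x \in K).
  have := congr1 (fun e : {set I} => x \in e) e.
  by rewrite /= !tri_edgeK // -ii'; do 2!case: (x \in _); case: (i == _).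
by apply/idP/idP => h; case/negP: xK; [apply: (fintype.subsetP TK)|
  apply: (fintype.subsetP TK')].
Qed.

Lemma tri_edge_sub T i : T \subset K -> tri_edge T i \subset C.
Proof.
move=> TK; rewrite !finset.subUset !finset.sub1set !PC /=.
by case: ifP => _; apply: fintype.subset_trans core_rest_sub => //; apply: finset.subsetDl.
Qed.

(** A corner [P a] misses edge a + 1, a point of [T] misses edge 1, and any other vertex misses edge
    0. *)
Lemma tri_edge_cap T v : T \subset K -> exists i, v \notin tri_edge T i.
Proof.
move=> TK; have [/imsetP[a _ ->]|vP] := boolP (v \in [set P i | i : 'Z_3]).
  exists (a + 1)%R; rewrite tri_edgeP //.
  by case: a => [[|[|[|a]]] ha].
have [vT|vT] := boolP (v \in T).
  by exists 1%R; rewrite tri_edgeK ?vT // (fintype.subsetP TK).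
exists 0%R; rewrite !inE (negbTE vT) orbF.
by apply: contra vP => /orP[] /eqP ->; apply: imset_f.
Qed.

Definition tri_index := {T : {set I} | T \in powerset K}.

Lemma tri_indexP (T : tri_index) : val T \subset K.
Proof. by have := valP T; rewrite inE. Qed.

Definition tri_cycle (T : tri_index) : cycle3 I :=
  ([ffun i => P i], [ffun i => tri_edge (val T) i]).

Definition tri_edges (T : tri_index) := [set tri_edge (val T) i | i : 'Z_3].

(** By [tri_edge_cap] the [pick] always succeeds, so the default index is never taken. *)
Definition tri_avoid (T : tri_index) (v : I) : {set I} :=
  tri_edge (val T) (odflt 0%R [pick i | v \notin tri_edge (val T) i]).

Lemma tri_edges_sub (T : tri_index) e : e \in tri_edges T -> e \subset C.
Proof. by move=> /imsetP[i _ ->]; apply: tri_edge_sub; apply: tri_indexP. Qed.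

Lemma tri_edges_neq0 (T : tri_index) : finset.set0 \notin tri_edges T.
Proof.
apply/imsetP => -[i _ e].
have : P i \in tri_edge (val T) i := finset.setU11 _ _.
by rewrite -e inE.
Qed.

Lemma tri_edges_disj (T T' : tri_index) e : e \in tri_edges T -> e \in tri_edges T' -> T = T'.
Proof.
move=> /imsetP[i _ ->] /imsetP[i' _ /tri_edge_inj[]]; try exact: tri_indexP.
by move=> _ /val_inj.
Qed.

Lemma tri_avoid_in (T : tri_index) v : tri_avoid T v \in tri_edges T.
Proof. exact: imset_f. Qed.

Lemma tri_avoidP (T : tri_index) v : v \notin tri_avoid T v.
Proof.
rewrite /tri_avoid; case: pickP => //= h.
by have [i hi] := tri_edge_cap v (tri_indexP T); have := h i; rewrite hi.
Qed.

Lemma tri_cycleP (T : tri_index) (H : hypergraph I) : C \subset vertices H ->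
  is_triangle H (tri_cycle T) = (tri_edges T \subset edges H).
Proof.
move=> CH; rewrite /is_triangle /=.
have -> : injectiveb [ffun i => P i] by apply/injectiveP => i j; rewrite !ffunE => /Pinj.
have -> : injectiveb [ffun i => tri_edge (val T) i].
  apply/injectiveP => i j; rewrite !ffunE => /tri_edge_inj[] //; exact: tri_indexP.
have -> : [forall i, [ffun i => P i] i \in vertices H].
  by apply/forallP => i; rewrite ffunE (fintype.subsetP CH).
have -> : [forall i, [ffun i0 => P i0] i \in
   ([ffun i0 => tri_edge (val T) i0] (i - 1)%R :&: [ffun i0 => tri_edge (val T) i0] i)%SET].
  apply/forallP => i; rewrite inE !ffunE !tri_edgeP ?tri_indexP //.
  by rewrite GRing.subrK eqxx orbT.
rewrite andbT; apply/forallP/fintype.subsetP => [h e /imsetP[i _ ->]|h i].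
  by have := h i; rewrite ffunE.
by rewrite ffunE h // imset_f.
Qed.

(** Edge i + 1 contains only the corners [P (i + 1)] and [P (i + 2)], so these triangles are always
    induced. *)
Lemma tri_cycle_induced (T : tri_index) (H : hypergraph I) : C \subset vertices H ->
  is_induced_triangle H (tri_cycle T) = (tri_edges T \subset edges H).
Proof.
move=> CH; rewrite /is_induced_triangle tri_cycleP // andb_idr // => _.
apply/forallP => i; rewrite /= !ffunE tri_edgeP ?tri_indexP //.
by case: i => [[|[|[|i]]] hi].
Qed.

Definition triangle_gadgets : gadgets AllTriangles C.
Proof.
apply: (@Gadgets AllTriangles I C tri_index tri_edges tri_cycle tri_avoid).
- exact: tri_edges_sub.
- exact: tri_edges_neq0.
- exact: tri_edges_disj.
- exact: tri_avoid_in.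
- exact: tri_avoidP.
- by move=> T H /tri_cycleP <-; rewrite inE.
Defined.

Definition induced_triangle_gadgets : gadgets InducedTriangles C.
Proof.
apply: (@Gadgets InducedTriangles I C tri_index tri_edges tri_cycle tri_avoid).
- exact: tri_edges_sub.
- exact: tri_edges_neq0.
- exact: tri_edges_disj.
- exact: tri_avoid_in.
- exact: tri_avoidP.
- by move=> T H /tri_cycle_induced <-; rewrite inE.
Defined.

Lemma card_tri_index : #|{: tri_index}| = (2 ^ (#|C| - 3))%N.
Proof.
rewrite card_sig -card_core_rest -card_powerset.
by apply: eq_card => T; rewrite inE.
Qed.

(* Two distinct sets sharing a facet have distinct codes, so the simplices of one
   code class have pairwise disjoint sets of facets; there are only polynomially
   many classes. *)
Definition code (S : {set I}) : nat := \sum_(x in S) index x (enum C).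

(* Adding the three corners ensures dimension at least 2. *)
Definition simplex_of (T : {set I}) : {set I} := T :|: (C :\: K).

Definition code_class (a : nat) : {set {set I}} :=
  [set T in powerset K | code (simplex_of T) == a].

Lemma simplex_of_sub T : T \subset K -> simplex_of T \subset C.
Proof.
by move=> TK; rewrite finset.subUset finset.subsetDl (fintype.subset_trans TK core_rest_sub).
Qed.

Lemma code_simplex_of T : T \subset K -> code (simplex_of T) < (#|C| * #|C|).+1.
Proof.
move=> /simplex_of_sub TC; rewrite ltnS /code.
apply: leq_trans (_ : \sum_(x in simplex_of T) #|C| <= _).
  apply: leq_sum => x xT; rewrite cardE; apply: ltnW; rewrite index_mem mem_enum.
  exact: (fintype.subsetP TC).
by rewrite sum_nat_const leq_mul2r (fintype.subset_leq_card TC) orbT.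
Qed.

(** Pigeonhole: the subsets of [K] are distributed over at most |C|^2 + 1 codes. *)
Lemma code_class_large :
  exists a, 2 ^ (#|C| - 3) <= (#|C| * #|C|).+1 * #|code_class a|.
Proof.
pose n := (#|C| * #|C|).+1.
suff /existsP[a ha] : [exists a : 'I_n, 2 ^ (#|C| - 3) <= n * #|code_class a|].
  by exists a.
apply: contraT; rewrite negb_exists => /forallP h.
have : \sum_(a < n) #|code_class a| = (2 ^ (#|C| - 3))%N.
  rewrite -card_core_rest -card_powerset -[RHS]sum1_card.
  rewrite (partition_big (fun T => inord (code (simplex_of T)) : 'I_n) xpredT) //=.
  apply: eq_bigr => a _; rewrite -[LHS]sum1_card; apply: eq_bigl => T.
  rewrite inE; case TK : (T \in powerset K) => //=.
  by rewrite -val_eqE /= inordK // code_simplex_of // -powersetE.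
have : \sum_(a < n) (n * #|code_class a|).+1 <= \sum_(a < n) (2 ^ (#|C| - 3))%N.
  by apply: leq_sum => a _; rewrite ltnNge h.
rewrite sum_nat_const card_ord.
under eq_bigr do rewrite -addn1.
rewrite big_split /= -big_distrr /= sum1_card card_ord => hle hsum.
by move: hle; rewrite hsum addnS ltnNge leq_addr.
Qed.

(** Removing the common facet from equal codes leaves equal indices in [enum C], so the two removed
    vertices coincide. *)
Lemma code_facet S S' x x' : S \subset C -> S' \subset C -> code S = code S' ->
  x \in S -> x' \in S' -> S :\ x = S' :\ x' -> S = S'.
Proof.
move=> SC SC' + xS xS' e; rewrite /code (big_setD1 x) //= (big_setD1 x' xS') /= e.
move=> /addIn h; suff xx' : x = x'.
  by rewrite -(finset.setD1K xS) e {1}xx' finset.setD1K.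
have xC : x \in enum C by rewrite mem_enum (fintype.subsetP SC).
have xC' : x' \in enum C by rewrite mem_enum (fintype.subsetP SC').
by rewrite -(nth_index x xC) h nth_index.
Qed.

Section SimplexGadgets.
Variable a : nat.

Definition simplex_index := {S : {set I} | S \in code_class a}.

Implicit Type t : simplex_index.

Definition simplex (t : simplex_index) : {set I} := simplex_of (val t).

Lemma simplex_indexP (t : simplex_index) :
  val t \subset K /\ code (simplex t) = a.
Proof. by have := valP t; rewrite !inE => /andP[? /eqP]. Qed.

Lemma simplex_sub t : simplex t \subset C.
Proof. by case: (simplex_indexP t) => TK _; apply: simplex_of_sub. Qed.

Lemma simplex_corner t i : P i \in simplex t.
Proof. by rewrite inE [_ \in _ :\: _]inE PC core_restP orbT. Qed.

Lemma simplex_card t : 2 < #|simplex t|.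
Proof.
apply: leq_trans (_ : #|[set P i | i : 'Z_3]| <= _).
  by rewrite card_imset // card_ord.
apply: fintype.subset_leq_card; apply/fintype.subsetP => _ /imsetP[i _ ->].
exact: simplex_corner.
Qed.

Lemma simplex_inj : injective simplex.
Proof.
move=> t t' e; apply/val_inj/finset.setP => x.
have TK := (simplex_indexP t).1; have TK' := (simplex_indexP t').1.
have [xK|xK] := boolP (x \in K).
  have := congr1 (fun e : {set I} => x \in e) e.
  by rewrite /= !finset.in_setU finset.in_setD xK !orbF.
by apply/idP/idP => h; case/negP: xK; [apply: (fintype.subsetP TK)|
  apply: (fintype.subsetP TK')].
Qed.

Definition simplex_edges (t : simplex_index) : {set {set I}} :=
  [set simplex t :\ x | x in simplex t].

Definition simplex_avoid (t : simplex_index) (v : I) : {set I} :=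
  simplex t :\ (if v \in simplex t then v else P 0%R).

Lemma simplex_edges_sub t e : e \in simplex_edges t -> e \subset C.
Proof.
move=> /imsetP[x _ ->]; apply: fintype.subset_trans (simplex_sub t).
exact: finset.subsetDl.
Qed.

Lemma simplex_edges_neq0 t : finset.set0 \notin simplex_edges t.
Proof.
apply/imsetP => -[x xT e]; have := simplex_card t.
by rewrite (cardsD1 x) xT -e cards0.
Qed.

Lemma simplex_edges_disj t t' e :
  e \in simplex_edges t -> e \in simplex_edges t' -> t = t'.
Proof.
move=> /imsetP[x xT ->] /imsetP[x' xT' e']; apply: simplex_inj.
apply: code_facet xT xT' e'; rewrite ?simplex_sub //.
by rewrite (simplex_indexP t).2 (simplex_indexP t').2.
Qed.

Lemma simplex_avoid_in t v : simplex_avoid t v \in simplex_edges t.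
Proof. by apply: imset_f; case: ifP => // _; apply: simplex_corner. Qed.

Lemma simplex_avoidP t v : v \notin simplex_avoid t v.
Proof.
rewrite /simplex_avoid finset.in_setD1.
by case: ifP => _; rewrite ?eqxx ?andbF.
Qed.

Lemma simplexP t (H : hypergraph I) : C \subset vertices H ->
  is_simplex H (simplex t) = (simplex_edges t \subset edges H).
Proof.
move=> CH; have T2 := simplex_card t.
rewrite /is_simplex /is_simplex_of_dim (fintype.subset_trans (simplex_sub t) CH).
have -> : 1 < #|simplex t|.-1 by lia.
have -> : #|simplex t| == #|simplex t|.-1.+1 by apply/eqP; lia.
rewrite /=; apply/forallP/fintype.subsetP => [h _ /imsetP[x xT ->]|h F].
  have /implyP := h (simplex t :\ x); apply; rewrite finset.subsetDl /=.
  by rewrite [in X in _ == X](cardsD1 x) xT.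
apply/implyP => /andP[FT /eqP cF].
(* A subset with one element fewer is the simplex minus a single vertex. *)
have : #|simplex t :\: F| = 1%N by rewrite cardsD (finset.setIidPr FT) cF; lia.
move=> /eqP/cards1P[x ex]; apply: h.
have xT : x \in simplex t.
  by apply: (fintype.subsetP (finset.subsetDl _ F)); rewrite ex finset.set11.
apply/imsetP; exists x => //; rewrite -ex finset.setDDr finset.setDv finset.set0U.
by rewrite (finset.setIidPr FT).
Qed.

Definition simplex_gadgets : gadgets AllSimplices C.
Proof.
apply: (@Gadgets AllSimplices I C simplex_index simplex_edges simplex simplex_avoid).
- exact: simplex_edges_sub.
- exact: simplex_edges_neq0.
- exact: simplex_edges_disj.
- exact: simplex_avoid_in.
- exact: simplex_avoidP.
- by move=> t H /simplexP <-; rewrite inE.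
Defined.

End SimplexGadgets.

Lemma gadgets_exist pb :
  exists G : gadgets pb C, 2 ^ (#|C| - 3) <= (#|C| * #|C|).+1 * #|gindex G|.
Proof.
case: pb.
- by exists triangle_gadgets; rewrite card_tri_index leq_pmull.
- by exists induced_triangle_gadgets; rewrite card_tri_index leq_pmull.
have [a ha] := code_class_large; exists (simplex_gadgets a).
apply: leq_trans ha _; rewrite leq_mul2l; apply/orP; right.
by rewrite card_sig; apply/eq_leq/eq_card.
Qed.

End GadgetConstructions.

Lemma core_corners (I : finType) (C : {set I}) : 2 < #|C| ->
  exists2 P : 'Z_3 -> I, (forall i, P i \in C) & injective P.
Proof.
move=> C3; exists (fun i => enum_val (widen_ord C3 i)).
  by move=> i; apply: enum_valP.
by move=> i j /enum_val_inj /(congr1 val) /= ij; apply/val_inj.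
Qed.

(** * From counting to rounds *)

Local Open Scope ring_scope.

Lemma rounds_of_counting (k b t M : nat) (m := (M %/ (2 * k))%N) : (2 < k)%N ->
  (2 ^ (k - 3) <= (k * k).+1 * M)%N ->
  (k.+1 ^ m <= 4 * (k * (2 ^ b).+1 ^ (t * k)) * k ^ m)%N ->
  (2 ^ k <= 32 * k ^ 5 * (2 + b.+1 * t))%N.
Proof.
move=> k2 hM hm; have k0 : (0 < k)%N by apply: leq_trans k2.
pose q := (m %/ k)%N.
(* Base-2 logarithm of the counting bound, using k <= 2^k and 2^b + 1 <= 2^(b+1). *)
have hq : (q <= 2 + k + b.+1 * (t * k))%N.
  rewrite -(leq_exp2l _ _ (ltnSn 1)) -(leq_pmul2r (_ : 0 < k ^ m)%N); last first.
    by rewrite expn_gt0 k0.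
  apply: leq_trans (double_pow_leq m k0) _; apply: leq_trans hm _.
  rewrite leq_mul2r; apply/orP; right.
  have : ((2 ^ b).+1 ^ (t * k) <= 2 ^ (b.+1 * (t * k)))%N.
    rewrite (expnM 2); case: (t * k)%N => // e; rewrite leq_exp2r //.
    by rewrite expnS mul2n -addnn -addn1 leq_add2l expn_gt0.
  move: (b.+1 * _)%N => r hr; rewrite !expnD -mulnA leq_mul2l /=.
  by apply: leq_mul hr; apply/ltnW/ltn_expl.
have mq : (m < q.+1 * k)%N by rewrite ltn_ceil.
have Mm : (M < m.+1 * (2 * k))%N by rewrite ltn_ceil // muln_gt0.
have M1 : (M <= 2 * k ^ 3 * (2 + b.+1 * t))%N.
  apply: leq_trans (ltnW Mm) _.
  apply: leq_trans (_ : q.+1 * k * (2 * k) <= _)%N; first by rewrite leq_mul2r mq orbT.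
  apply: leq_trans (_ : (3 + k + b.+1 * (t * k)) * k * (2 * k) <= _)%N.
    by rewrite !leq_mul2r; apply/orP; right; apply/orP; right; lia.
  apply: leq_trans (_ : (k + k + b.+1 * (t * k)) * k * (2 * k) <= _)%N.
    by rewrite !leq_mul2r; apply/orP; right; apply/orP; right; lia.
  by apply/eq_leq; rewrite !expnS expn0; ring.
(* The constant 32 arises from 2^k = 8 * 2^(k-3), k^2 + 1 <= 2 k^2 and the factor 2 in [M1]. *)
rewrite -(subnKC k2) expnD.
apply: leq_trans (_ : 8 * ((k * k).+1 * M) <= _)%N; first by rewrite leq_mul2l hM orbT.
apply: leq_trans (_ : 8 * ((2 * (k * k)) * (2 * k ^ 3 * (2 + b.+1 * t))) <= _)%N.
  rewrite leq_mul2l; apply: leq_mul M1; by nia.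
by rewrite subnKC //; apply/eq_leq; rewrite !expnS expn0; ring.
Qed.

(** The restricted edges are subsets of [C], hence at most 2^|C| many, and each has size at most
    |U|. *)
Lemma max_density_le (R : realType) (I : finType) (H : hypergraph I) (C : {set I}) :
  (forall e, e \in edges H -> e \subset C) -> max_density R H <= 2 ^+ #|C|.
Proof.
move=> HC; apply: bigmax_le => [|U /andP[U0 _]]; first exact: exprn_ge0.
have cU : (0 < #|U|)%N by rewrite card_gt0.
rewrite /density ler_pdivrMr ?ltr0n // -natrX -natrM ler_nat.
rewrite -card_powerset -sum_nat_const.
apply: leq_trans (_ : \sum_(f in restr_edges H U) #|U| <= _)%N.
  apply: leq_sum => f /imsetP[e _ ->]; exact/fintype.subset_leq_card/finset.subsetIr.
rewrite !sum_nat_const leq_mul2r; apply/orP; right; apply: fintype.subset_leq_card.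
apply/fintype.subsetP => f /imsetP[e]; rewrite !inE => /andP[/HC eC _] ->.
exact: fintype.subset_trans (finset.subsetIl _ _) eC.
Qed.

(** Averaging over the random source: the expected number of successful inputs is at least 3/4 of
    all, so some fixed outcome attains this and the algorithm becomes deterministic. *)
Lemma exists_good_seed (R : realType) (d : measure_display)
    (Omega : measurableType d) (P : probability Omega R) (X : finType)
    (S : X -> set Omega) : (0 < #|X|)%N ->
  (forall x, measurable (S x) /\ ((3 / 4 : R)%:E <= P (S x))%E) ->
  exists w, (3 * #|X| <= 4 * #|[set x | `[< S x w >]]|)%N.
Proof.
move=> X0 hS; apply: contrapT => /forallNP hw.
(* The largest integer with 4 N < 3 |X|. *)
pose N := ((3 * #|X|).-1 %/ 4)%N.
have cN w : (#|[set x | `[< S x w >]]| <= N)%N.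
  by have /negP := hw w; rewrite -ltnNge /N; move: #|_| => c; lia.
have sumE w : (\sum_x (\1_(S x) w)%:E = (#|[set x | `[< S x w >]]|%:R : R)%:E)%E.
  rewrite sumEFin; congr (_%:E); rewrite -sum1_card natr_sum [RHS]big_mkcond.
  apply: eq_bigr => x _; rewrite indicE finset.inE.
  by case: asboolP => Sxw; [rewrite mem_set | rewrite memNset].
have mS x : measurable_fun setT (fun w => (\1_(S x) w : R)%:E).
  by apply/measurable_EFinP/measurable_indic; have [] := hS x.
have : (\int[P]_w (\sum_x (\1_(S x) w : R)%:E) <= \int[P]_w (cst (N%:R : R)%:E) w)%E.
  apply: ge0_le_integral => //.
  - by move=> w _; apply: sume_ge0 => x _; rewrite lee_fin indicE.
  - exact: emeasurable_sum.
  - by move=> w _; rewrite sumE lee_fin ler_nat.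
rewrite integral_cst // [X in (_ * X)%E](probability_setT P) mule1.
rewrite ge0_integral_sum //.
under eq_bigr => x _.
  rewrite integral_indic // ?setIT; last by have [] := hS x.
over.
apply/negP; rewrite -ltNge.
apply: lt_le_trans (_ : \sum_(x : X) (3 / 4 : R)%:E <= _)%E; last first.
  by apply: lee_sum => x _; have [] := hS x.
rewrite sumEFin lte_fin sumr_const -mulr_natr.
have : (4 * N < 3 * #|X|)%N by rewrite /N; lia.
rewrite -(ltr_nat R) !natrM; lra.
Qed.

Lemma exists_subset_card (I : finType) (V : {set I}) k : (k <= #|V|)%N ->
  exists2 C : {set I}, C \subset V & #|C| = k.
Proof.
move=> kV; exists [set x in take k (enum V)].
  by apply/fintype.subsetP => x; rewrite inE => /mem_take; rewrite mem_enum.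
rewrite cardsE; have /card_uniqP-> : uniq (take k (enum V)).
  by rewrite take_uniq // enum_uniq.
by rewrite size_takel // -cardE.
Qed.

Lemma solves_rounds (R : realType) (d : measure_display)
    (Omega : measurableType d) (P : probability Omega R) (l b : nat)
    (pb : problem) (A : pc_algorithm Omega l b pb) (n : nat) (mu : R)
    (t k : nat) (V : {set l.-tuple bool}) :
  solves P A n mu t (3 / 4) -> #|V| = n -> (2 < k <= n)%N -> 2 ^+ k <= mu ->
  (2 ^ k <= 32 * k ^ 5 * (2 + b.+1 * t))%N.
Proof.
move=> hA cV /andP[k2]; rewrite -{1}cV => kV kmu; have [C CV cC] := exists_subset_card kV.
have C2 : (2 < #|C|)%N by rewrite cC.
have [p pC pinj] := core_corners C2.
have [G hG] := gadgets_exist pC pinj pb.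
rewrite -cC; apply: (rounds_of_counting C2 hG).
have C0 : (0 < #|C|)%N by apply: leq_trans C2.
have X0 : (0 < #|{: input G}|)%N.
  by rewrite card_ffun expn_gt0 card_prod card_bool cardQ muln_gt0 C0.
have hx (x : input G) : let S := success A (input_hypergraph CV x) t in
    measurable S /\ ((3 / 4 : R)%:E <= P S)%E.
  apply: hA => //; apply: le_trans kmu; rewrite -cC.
  by apply: max_density_le => e; apply: input_edges_sub.
have [w hw] := exists_good_seed X0 hx.
exact: (@counting_bound _ _ _ _ A w t C V G CV C0 hw).
Qed.

(** * Asymptotic estimates *)

Lemma expR_ge_pow6 (R : realType) (x : R) : 0 <= x -> (x / 6) ^+ 6 <= expR x.
Proof.
move=> x0; rewrite [in leRHS](_ : x = 6%:R * (x / 6)); last by field.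
rewrite expRM_natl lerXn2r ?nnegrE ?expR_ge0 ?divr_ge0 //.
by apply: le_trans (expR_ge1Dx _); rewrite lerDr.
Qed.

Lemma pow5_le_powR (R : realType) (delta : R) : 0 < delta ->
  exists k0 : nat, forall k, (k0 <= k)%N ->
    256 * k%:R ^+ 5 <= (2 ^+ k) `^ delta.
Proof.
move=> d0; have l2 : 0 < ln 2 :> R by rewrite ln_gt0 // ltr1n.
pose a : R := (delta * ln 2 / 6) ^+ 6.
have a0 : 0 < a by rewrite exprn_gt0 // divr_gt0 // mulr_gt0.
(* The sixth-power lower bound on the exponential is a * k^6, which exceeds 256 k^5 once a * k >=
   256. *)
exists (Num.truncn (256 / a)).+1 => k hk.
have ka : 256 <= a * k%:R.
  rewrite mulrC -ler_pdivrMr //; apply/ltW.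
  by apply: lt_le_trans (truncnS_gt _) _; rewrite ler_nat.
apply: le_trans (_ : (delta * k%:R * ln 2 / 6) ^+ 6 <= _).
  apply: le_trans (_ : a * k%:R * k%:R ^+ 5 <= _).
    by rewrite ler_wpM2r // exprn_ge0.
  by rewrite le_eqVlt; apply/orP; left; apply/eqP; rewrite /a; ring.
apply: le_trans (expR_ge_pow6 _) _; first by rewrite !mulr_ge0 // ltW.
rewrite -powR_mulrn // -powRrM /powR pnatr_eq0 /=.
by rewrite ler_expR le_eqVlt [delta * _]mulrC eqxx.
Qed.

Lemma exp2_bracket (R : realType) (x : R) : 1 <= x ->
  exists k, 2 ^+ k <= x < 2 ^+ k.+1.
Proof.
move=> x1; have x0 : 0 <= x by apply: le_trans x1.
have /andP[h1 h2] := truncn_itv x0.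
have N0 : (0 < Num.truncn x)%N.
  by rewrite lt0n; apply: contraTneq h2 => ->; rewrite -leNgt.
have /andP[h3 h4] := trunc_log_bounds (ltnSn 1) N0.
exists (trunc_log 2 (Num.truncn x)); rewrite -!natrX; apply/andP; split.
  by apply: le_trans h1; rewrite ler_nat.
by apply: lt_le_trans h2 _; rewrite ler_nat.
Qed.

Local Open Scope classical_set_scope.
Local Open Scope ring_scope.

Lemma Theta_ln_bound (R : realType) (B : nat -> nat) :
  (fun n : nat => (B n)%:R : R^o) =Theta_\oo (fun n : nat => ln n%:R : R^o) ->
  exists (K : R) (n0 : nat), 0 < K /\ forall n, (n0 <= n)%N ->
    0 < ln n%:R :> R /\ (B n).+1%:R <= K * ln n%:R.
Proof.
rewrite eqThetaE qualifE => /asboolP[[k1 K] /= /andP[_ K0] [n0 _ h]].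
(* For n > e the logarithm is at least 1, so raising [K] by 1 absorbs the successor of [B n]. *)
exists (K + 1), (maxn n0 (Num.truncn (expR 1 : R)).+1); split=> [|n].
  by rewrite addr_gt0.
rewrite geq_max => /andP[/h[_ /= hB] hn].
have ln1 : 1 <= ln n%:R :> R.
  have e0 : expR 1 < n%:R :> R.
    by apply: lt_le_trans (truncnS_gt _) _; rewrite ler_nat.
  by rewrite -[leLHS]expRK ler_ln ?posrE ?expR_gt0 ?ltW // (lt_trans _ e0) // expR_gt0.
have ln0 : 0 < ln n%:R :> R by apply: lt_le_trans ln1.
split=> //; move: hB; rewrite ger0_norm ?(ger0_norm (ltW ln0)) // => hB.
by rewrite -natr1 mulrDl mul1r lerD ?hB.
Qed.

Theorem theorem50 (R : realType) :
  exists2 p0 : R, 0 < p0 < 1 &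
  forall (pb : problem) (eps : R), 0 < eps ->
  forall B ell : nat -> nat,
    (fun n : nat => (B n)%:R : R^o) =Theta_\oo (fun n : nat => ln n%:R : R^o) ->
    (fun n : nat => (ell n)%:R : R^o) =O_\oo (fun n : nat => ln n%:R : R^o) ->
    (forall n : nat, (n <= 2 ^ ell n)%N) ->
  exists c mu0 : R, 0 < c /\
  forall (n : nat) (mu : R),
    (exists2 H : hypergraph ((ell n).-tuple bool),
       #|vertices H| = n & max_density R H = mu) ->
    mu0 <= mu ->
  forall (d : measure_display) (Omega : measurableType d)
    (P : probability Omega R) (A : pc_algorithm Omega (ell n) (B n) pb) (t : nat),
    solves P A n mu t p0 ->
    c * (mu `^ (1 - eps) / ln n%:R) <= t%:R.
Proof.
exists (3 / 4); first lra.
move=> pb eps eps0 B ell /Theta_ln_bound[K [n0 [K0 hB]]] _ _.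
have [k1 hk1] := pow5_le_powR eps0.
(* Exponent [eps] serves to absorb the polynomial into mu^eps; exponent 1 makes the additive term 64
   k^5 at most a quarter of 2^k. *)
have [k2 hk2] := pow5_le_powR (ltr01 : 0 < 1 :> R).
exists K^-1, (2 ^+ (n0 + k1 + k2 + 3)); split; first by rewrite invr_gt0.
move=> n mu [H cH dH] mu_ge d Omega P A t hA.
(* Realizability of [mu] on n vertices ensures that a core of size k fits, as 2^k <= mu <= 2^n. *)
have mu_n : mu <= 2 ^+ n.
  by have := max_density_le R (@edges_sub _ H); rewrite dH cH.
have two1 : 1 < 2 :> R by rewrite ltr1n.
have [k /andP[kmu muk]] : exists k, 2 ^+ k <= mu < 2 ^+ k.+1.
  by apply: exp2_bracket; apply: le_trans mu_ge; apply: exprn_ege1; apply: ltW.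
have k_ge : (n0 + k1 + k2 + 3 <= k)%N.
  by rewrite -ltnS -(ltr_eXn2l two1) (le_lt_trans mu_ge).
have kn : (k <= n)%N by rewrite -(ler_eXn2l two1) (le_trans kmu).
have [L0 hBn] : 0 < ln n%:R :> R /\ (B n).+1%:R <= K * ln n%:R by apply: hB; lia.
have kk1 : 256 * k%:R ^+ 5 <= (2 ^+ k) `^ eps by apply: hk1; lia.
have kk2 : 256 * k%:R ^+ 5 <= 2 ^+ k :> R.
  by rewrite -[leRHS]powRr1 ?exprn_ge0 //; apply: hk2; lia.
have k2n : (2 < k <= n)%N by rewrite kn andbT; lia.
have := solves_rounds hA cH k2n kmu; rewrite -(ler_nat R).
rewrite natrX 2!natrM natrX natrD natrM => hk.
set L := ln n%:R in L0 hBn *; set b := (B n).+1%:R in hBn hk.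
have mu0 : 0 < mu by apply: lt_le_trans kmu; apply: exprn_gt0.
have me : 256 * k%:R ^+ 5 <= mu `^ eps.
  by apply: le_trans kk1 _; apply: ge0_ler_powR; rewrite ?nnegrE ?exprn_ge0 // ltW.
have bt : b * t%:R <= K * L * t%:R by rewrite ler_wpM2r.
have KLt0 : 0 <= K * L * t%:R by rewrite !mulr_ge0 // ltW.
have c5 : 0 <= k%:R ^+ 5 :> R by rewrite exprn_ge0.
have mu_le : mu <= mu `^ eps * (K * L * t%:R).
  apply: le_trans (_ : 256 * k%:R ^+ 5 * (K * L * t%:R) <= _); last first.
    by rewrite ler_wpM2r.
  (* With mu < 2 * 2^k and 64 k^5 <= 2^k / 4, the round bound gives mu <= (8/3) * 32 k^5 * b * t,
     within the constant 256. *)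
  have : k%:R ^+ 5 * (b * t%:R) <= k%:R ^+ 5 * (K * L * t%:R) by rewrite ler_wpM2l.
  move: muk hk kk2; rewrite exprS; move: (2 ^+ k) (k%:R ^+ 5) => x y; lra.
have me0 : 0 < mu `^ eps by rewrite powR_gt0.
rewrite mulrC ler_pdivrMr // ler_pdivrMr // -(ler_pM2l me0) -powRD; last first.
  by rewrite (gt_eqF mu0) implybT.
rewrite addrC subrK powRr1 ?(ltW mu0) //.
have -> // : t%:R * K * L = K * L * t%:R by ring.
Qed.
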